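(* Let $G$ be a regular graph and let $k < \Delta(G)/2$. Suppose every edge precoloring of $G$ with colors from $\{1,\dots,\chi'(G)\}$ whose precolored edges are at most $k$ independent edges is extendable to a proper $\chi'(G)$-edge coloring of $G$. Then every edge precoloring of $G \square K_2$ with colors from $\{1,\dots,\chi'(G)+1\}$ whose precolored edges are at most $k+1$ independent edges is extendable to a proper $(\chi'(G)+1)$-edge coloring of $G \square K_2$.
   Context: $G \square H$ denotes the cartesian product of graphs. $\chi'(G)$ is the chromatic index and $\Delta(G)$ the maximum degree. Independent edges means pairwise non-adjacent edges (a matching). An edge precoloring is a proper edge coloring of some subset of the edges; it is extendable to a proper $t$-edge coloring if there is a proper edge coloring $f$ with colors $\{1,\dots,t\}$ agreeing with it on all precolored edges. *)

(* Defs.v *)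
From mathcomp Require Import all_boot.

Set Implicit Arguments.
Unset Strict Implicit.
Unset Printing Implicit Defensive.

Record sgraph := SGraph {
  vertex :> finType;
  adj : rel vertex;
  adj_sym : symmetric adj;
  adj_irr : irreflexive adj
}.

Section Graph.
Variable G : sgraph.

Definition degree (x : G) : nat := #|[set y | adj x y]|.

Definition max_degree : nat := \max_(x : G) degree x.

Definition regular : Prop := exists d, forall x : G, degree x = d.

Definition edge_set : {set {set G}} :=
  [set e | [exists x, exists y, adj x y && (e == [set x; y])]].

Definition edge : finType := {e : {set G} | e \in edge_set}.

Definition edge_adj (e1 e2 : edge) : bool :=
  (e1 != e2) && ~~ [disjoint val e1 & val e2].

Definition independent (M : {set edge}) : Prop :=
  {in M &, forall e1 e2, ~~ edge_adj e1 e2}.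

(* The colors {1, ..., t} are represented by 'I_t, i.e. shifted to
   {0, ..., t - 1}. Colorings are defined on edges only, so that an edgeless
   graph has chromatic index 0. *)
Definition proper_coloring t (f : {ffun edge -> 'I_t}) : bool :=
  [forall e1, forall e2, edge_adj e1 e2 ==> (f e1 != f e2)].

Definition colorable (t : nat) : bool :=
  [exists f : {ffun edge -> 'I_t}, proper_coloring f].

Lemma colorable_exists : exists t, colorable t.
Proof.
exists #|edge|; apply/existsP; exists [ffun e => enum_rank e].
apply/forallP => e1; apply/forallP => e2; apply/implyP => /andP[ne12 _].
by rewrite !ffunE (inj_eq enum_rank_inj).
Qed.

Definition chromatic_index : nat := ex_minn colorable_exists.

(* [None] marks the edges that are not precolored. *)
Definition precolored t (p : {ffun edge -> option 'I_t}) : {set edge} :=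
  [set e | p e != None].

Definition proper_precoloring t (p : {ffun edge -> option 'I_t}) : Prop :=
  {in precolored p &, forall e1 e2, edge_adj e1 e2 -> p e1 <> p e2}.

Definition extendable t (p : {ffun edge -> option 'I_t}) : Prop :=
  exists2 f : {ffun edge -> 'I_t}, proper_coloring f &
    {in precolored p, forall e, p e = Some (f e)}.

End Graph.

Section CartesianProduct.
Variables G H : sgraph.

Definition cart_adj : rel (G * H) := fun u v =>
  ((u.1 == v.1) && adj u.2 v.2) || (adj u.1 v.1 && (u.2 == v.2)).

Lemma cart_adj_sym : symmetric cart_adj.
Proof.
move=> u v; rewrite /cart_adj (eq_sym u.1) (eq_sym u.2).
by rewrite (adj_sym u.1) (adj_sym u.2).
Qed.

Lemma cart_adj_irr : irreflexive cart_adj.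
Proof. by move=> u; rewrite /cart_adj !adj_irr andbF. Qed.

Definition cart_prod : sgraph := SGraph cart_adj_sym cart_adj_irr.

End CartesianProduct.

Section Complete.
Variable n : nat.

Definition complete_adj : rel 'I_n := fun i j => i != j.

Lemma complete_adj_sym : symmetric complete_adj.
Proof. by move=> i j; rewrite /complete_adj eq_sym. Qed.

Lemma complete_adj_irr : irreflexive complete_adj.
Proof. by move=> i; rewrite /complete_adj eqxx. Qed.

Definition complete_graph : sgraph := SGraph complete_adj_sym complete_adj_irr.

End Complete.

Notation "G □ H" := (cart_prod G H) (at level 40, left associativity).
Notation "''K_' n" := (complete_graph n) (at level 8, n at level 2, format "''K_' n").

(* Main.v *)
(* Choose a color [c], color each copy of [G] with the other colors, and give
   all vertical edges color [c]. If an edge [xy] has the same color [d] in both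
   copies, swapping [c] and [d] on the 4-cycle above [xy] keeps the coloring
   proper. Hence a vertical edge at [x] precolored [d <> c] is obtained by
   precoloring [d] some edge [xw] in both copies; since [2k < Delta], the
   neighbors [w] can be chosen distinct and away from all precolored edges. A
   precolored edge of color [c] in one copy is obtained by swapping on it, if
   both copies carry the same coloring.

   If both copies contain precolored edges, take [c] unused: each copy then has
   at most [k] prescribed edges. If one copy has none, take for [c] a color of
   the precoloring and color both copies identically: at least one precolored
   edge needs no prescription, which again leaves at most [k].

   Counts are made on covered vertices, twice the number of edges. *)
Require Import Defs.
From mathcomp Require Import all_boot.
From mathcomp Require Import zify.

Set Implicit Arguments.
Unset Strict Implicit.
Unset Printing Implicit Defensive.

(** * Unordered pairs and distinct representatives *)

Lemma set2_eq (T : finType) (x y x' y' : T) :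
  [set x; y] = [set x'; y'] -> (x = x' /\ y = y') \/ (x = y' /\ y = x').
Proof.
move=> E.
have : x \in [set x'; y'] by rewrite -E set21.
have : y \in [set x'; y'] by rewrite -E set22.
have : x' \in [set x; y] by rewrite E set21.
have : y' \in [set x; y] by rewrite E set22.
by rewrite !inE; do 4![case/orP=> /eqP ?]; subst; auto.
Qed.

Lemma set2_eql (T : finType) (x y z : T) : [set x; y] = [set x; z] -> y = z.
Proof. by case/set2_eq=> [[]|[<- ->]]. Qed.

(** A greedy choice works: when an element is treated, fewer than [#|D|] values are already taken.
    [u0] is a junk value outside [D]. *)
Lemma distinct_representatives (T U : finType) (N : T -> {set U}) (u0 : U)
    (D : {set T}) :
  (forall x, x \in D -> #|D| <= #|N x|) ->
  exists2 w : T -> U, {in D &, injective w} & forall x, x \in D -> w x \in N x.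
Proof.
suff greedy (s : seq T) : uniq s -> (forall x, x \in s -> size s <= #|N x|) ->
    exists2 w : T -> U, {in s &, injective w} & forall x, x \in s -> w x \in N x.
  move=> leN; case: (greedy (enum D)) => [|x|w winj wN]; first exact: enum_uniq.
    by rewrite mem_enum -cardE; apply: leN.
  exists w => [x y xD yD|x xD]; last by apply: wN; rewrite mem_enum.
  by apply: winj; rewrite mem_enum.
elim: s => [|x s IHs] /=; first by exists (fun=> u0).
case/andP=> xs us leN; case: (IHs us) => [y ys|w winj wN].
  by apply: ltnW; apply: leN; rewrite inE ys orbT.
have /subsetPn[z zN zw] : ~~ (N x \subset [seq w y | y <- s]).
  apply/negP => /subset_leq_card; apply/negP; rewrite -ltnNge.
  apply: leq_ltn_trans (card_size _) _; rewrite size_map.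
  by apply: leN; rewrite mem_head.
have wz y : y \in s -> w y <> z by move=> ys E; rewrite -E map_f in zw.
exists (fun y => if y == x then z else w y) => [y1 y2|y]; last first.
  by rewrite inE; case: eqP => [->|_] //=; apply: wN.
rewrite !inE; case: eqP => [->|_] /=; case: eqP => [->|_] //=.
- by move=> _ ys /esym/(wz _ ys).
- by move=> ys _ /(wz _ ys).
- exact: winj.
Qed.

(** * Partial maps and their domains *)

Section PartialMaps.
Variables (T : finType) (A : Type).
Implicit Types q r : T -> option A.

Definition pdom q : {set T} := [set x | isSome (q x)].

Definition pjoin q r x := if q x is Some a then Some a else r x.

Lemma pdom_Some q x a : q x = Some a -> x \in pdom q.
Proof. by rewrite inE => ->. Qed.

Lemma pdomP q x : reflect (exists a, q x = Some a) (x \in pdom q).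
Proof.
rewrite inE; case: (q x) => [a|] /=; constructor; first by exists a.
by case.
Qed.

Lemma pdomN q x : x \notin pdom q -> q x = None.
Proof. by rewrite inE; case: (q x). Qed.

Lemma pdom_join q r : pdom (pjoin q r) = pdom q :|: pdom r.
Proof. by apply/setP => x; rewrite !inE /pjoin; case: (q x). Qed.

Lemma pjoinl q r x a : q x = Some a -> pjoin q r x = Some a.
Proof. by rewrite /pjoin => ->. Qed.

Lemma pjoinr q r x a :
  [disjoint pdom q & pdom r] -> r x = Some a -> pjoin q r x = Some a.
Proof.
move=> qr rx; rewrite /pjoin pdomN //.
by apply/negP => /(disjointFr qr); rewrite (pdom_Some rx).
Qed.

End PartialMaps.

(** * Colored matchings and edge colorings as functions of vertices *)

Section ColoredMatchings.
Variable G : sgraph.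
Implicit Types x y z : G.

Lemma edge_exists x y : adj x y -> exists e : edge G, val e = [set x; y].
Proof.
move=> xy; have xyE : [set x; y] \in edge_set G.
  by rewrite inE; apply/existsP; exists x; apply/existsP; exists y; rewrite xy /=.
by exists (exist (fun e => e \in edge_set G) _ xyE).
Qed.

Lemma edge_ends (e : edge G) :
  exists xy : G * G, adj xy.1 xy.2 && (val e == [set xy.1; xy.2]).
Proof.
have := valP e; rewrite inE => /existsP[x /existsP[y xy]].
by exists (x, y).
Qed.

Lemma edge_val2 (e : edge G) x y : val e = [set x; y] -> adj x y.
Proof.
have [[x' y'] /= /andP[a /eqP ->]] := edge_ends e.
by case/set2_eq=> [[<- <-]|[<- <-]] //; rewrite adj_sym.
Qed.

Lemma edge_mem (e : edge G) x : x \in val e -> exists y, val e = [set x; y].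
Proof.
have [[x' y'] /= /andP[a /eqP ->]] := edge_ends e.
rewrite !inE => /orP[]/eqP->; first by exists y'.
by exists x'; rewrite setUC.
Qed.

Lemma card_edge (e : edge G) : #|val e| = 2.
Proof.
have [[x y] /= /andP[a /eqP ->]] := edge_ends e.
by rewrite cards2; case: eqP a => // ->; rewrite adj_irr.
Qed.

Lemma independent_eq (M : {set edge G}) (e1 e2 : edge G) x :
  independent M -> e1 \in M -> e2 \in M -> x \in val e1 -> x \in val e2 ->
  e1 = e2.
Proof.
move=> iM e1M e2M x1 x2; apply/eqP; apply: contraT => ne12.
have := iM _ _ e1M e2M; rewrite /edge_adj ne12 negbK /= => d12.
by have := disjointFr d12 x1; rewrite x2.
Qed.

(** Independent edges are disjoint as vertex sets, so the sizes of their two-element sets add up. *)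
Lemma card_independent (M : {set edge G}) :
  independent M -> 2 * #|M| = #|\bigcup_(e in M) val e|.
Proof.
move=> iM; have tM : trivIset [set val e | e in M].
  apply/trivIsetP => _ _ /imsetP[e1 e1M ->] /imsetP[e2 e2M ->] ne12.
  have := iM _ _ e1M e2M; rewrite /edge_adj negb_and !negbK.
  by case/orP=> // /eqP e12; rewrite e12 eqxx in ne12.
have := eqP tM; rewrite big_imset /=; last by move=> ? ? _ _ /val_inj.
rewrite cover_imset => <-; rewrite (eq_bigr (fun=> 2)) => [|e _].
  by rewrite sum_nat_const mulnC.
exact: card_edge.
Qed.

Section Colors.
Variable C : Type.

(* [q x = Some (y, c)] means that the edge [xy] belongs to the matching and has
   color [c]. *)
Definition cmatching (q : G -> option (G * C)) :=
  forall x y c, q x = Some (y, c) -> adj x y /\ q y = Some (x, c).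

Definition extends (q : G -> option (G * C)) (g : G -> G -> C) :=
  forall x y c, q x = Some (y, c) -> g x y = c.

Lemma cmatching_join q r :
  cmatching q -> cmatching r -> [disjoint pdom q & pdom r] ->
  cmatching (pjoin q r).
Proof.
move=> mq mr qr x y c; rewrite {1}/pjoin.
case qx: (q x) => [[y' c']|]; last first.
  by case/mr=> xy ry; split=> //; apply: pjoinr.
by case=> <- <-; have [xy qy] := mq _ _ _ qx; split=> //; apply: pjoinl.
Qed.

Lemma card_pdom_gt0 q :
  cmatching q -> pdom q != set0 -> 2 <= #|pdom q|.
Proof.
move=> mq /set0Pn[x xq]; have /pdomP[[y c] qx] := xq.
have [xy qy] := mq _ _ _ qx.
apply/card_gt1P; exists x, y; split=> //; first exact: pdom_Some qy.
by case: eqP xy => // ->; rewrite adj_irr.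
Qed.

Definition pfilter (q : G -> option (G * C)) (P : pred C) x :=
  if q x is Some (y, c) then if P c then Some (y, c) else None else None.

Lemma pfilterP q P x y c : pfilter q P x = Some (y, c) <-> q x = Some (y, c) /\ P c.
Proof.
rewrite /pfilter; case: (q x) => [[y' c']|]; last by split=> [|[]].
case: ifP => Pc'; split=> [|[]] // [<- <-] //.
by rewrite Pc'.
Qed.

Lemma cmatching_filter q P : cmatching q -> cmatching (pfilter q P).
Proof.
move=> mq x y c /pfilterP[/mq[xy qy] Pc]; split=> //.
exact/pfilterP.
Qed.

Lemma pdom_filter q P : pdom (pfilter q P) \subset pdom q.
Proof.
apply/subsetP => x /pdomP[[y c] /pfilterP[qx _]].
exact: pdom_Some qx.
Qed.

End Colors.

(** Working with ends instead of the subtype of edges makes recoloring easy. Properness concerns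
    adjacent pairs only; elsewhere the values are free up to symmetry. *)
Definition pair_coloring (C : eqType) (g : G -> G -> C) :=
  (forall x y, g x y = g y x) /\
  (forall x y z, adj x y -> adj x z -> y != z -> g x y != g x z).


Section ToPairs.
Variables (t : nat) (e0 : edge G).

(* Off the edges of [G] the value is junk, for which [e0] provides a color. *)
Definition pair_of (f : {ffun edge G -> 'I_t}) x y : 'I_t :=
  oapp f (f e0) (insub [set x; y]).

Lemma pair_ofE f (e : edge G) x y : val e = [set x; y] -> pair_of f x y = f e.
Proof. by move=> E; rewrite /pair_of -E valK. Qed.

Lemma pair_of_coloring f : proper_coloring f -> pair_coloring (pair_of f).
Proof.
move=> pf; split=> [x y|x y z xy xz yz]; first by rewrite /pair_of setUC.
have [[e1 E1] [e2 E2]] := (edge_exists xy, edge_exists xz).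
rewrite (pair_ofE _ E1) (pair_ofE _ E2).
apply: (implyP (forallP (forallP pf e1) e2)); rewrite /edge_adj; apply/andP; split.
  by apply: contraNneq yz => e12; apply/eqP/(@set2_eql _ x); rewrite -E1 -E2 e12.
by apply/pred0Pn; exists x; rewrite /= E1 E2 !set21.
Qed.

Definition edge_precoloring (q : G -> option (G * 'I_t)) :
    {ffun edge G -> option 'I_t} :=
  [ffun e : edge G => [pick c | [exists x, exists y,
     (val e == [set x; y]) && (q x == Some (y, c))]]].

Lemma edge_precoloringP q (e : edge G) c : edge_precoloring q e = Some c ->
  exists x y, val e = [set x; y] /\ q x = Some (y, c).
Proof.
rewrite ffunE; case: pickP => // c' /existsP[x /existsP[y /andP[/eqP E /eqP Q]]].
by case=> <-; exists x, y.
Qed.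

Lemma edge_precoloringE q (e : edge G) x y c : cmatching q ->
  val e = [set x; y] -> q x = Some (y, c) -> edge_precoloring q e = Some c.
Proof.
move=> mq E Q; case P: (edge_precoloring q e) => [c'|]; last first.
  move: P; rewrite ffunE; case: pickP => // /(_ c) /existsP[].
  by exists x; apply/existsP; exists y; rewrite E Q !eqxx.
have [x' [y' [E' Q']]] := edge_precoloringP P.
have [_ Q2] := mq _ _ _ Q'.
(* The color may have been read from either end of [e]; symmetry of the matching gives the same
   one. *)
move: E'; rewrite E => /set2_eq[[Ex Ey]|[Ex Ey]]; subst x' y'.
  by move: Q Q' => -> [->].
by move: Q Q2 => -> [->].
Qed.

(** Carries the hypothesis of the theorem from edges to vertices. The bound doubles because [pdom q]
    contains both ends of each prescribed edge. *)
Lemma matching_extension k :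
  (forall p : {ffun edge G -> option 'I_t}, proper_precoloring p ->
     independent (precolored p) -> #|precolored p| <= k -> extendable p) ->
  forall q : G -> option (G * 'I_t), cmatching q -> #|pdom q| <= 2 * k ->
  exists2 g, pair_coloring g & extends q g.
Proof.
move=> ext q mq leq_k; set p := edge_precoloring q.
have pE e z : e \in precolored p -> z \in val e ->
    exists y c, val e = [set z; y] /\ q z = Some (y, c).
  rewrite inE; case P: (p e) => [c|] // _.
  have [x [y [E Q]]] := edge_precoloringP P; have [_ Q'] := mq _ _ _ Q.
  rewrite E !inE => /orP[]/eqP->; first by exists y, c.
  by exists x, c; rewrite setUC.
have ip : independent (precolored p).
  move=> e1 e2 p1 p2; apply/negP => /andP[/eqP ne12 /pred0Pn[z /= /andP[z1 z2]]].
  have [y1 [c1 [E1 Q1]]] := pE _ _ p1 z1; have [y2 [c2 [E2 Q2]]] := pE _ _ p2 z2.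
  by apply/ne12/val_inj; rewrite E1 E2; move: Q2; rewrite Q1 => -[->].
have pp : proper_precoloring p.
  by move=> e1 e2 p1 p2 e12; have := ip _ _ p1 p2; rewrite e12.
have lep : #|precolored p| <= k.
  rewrite -(leq_pmul2l (ltn0Sn 1)) (card_independent ip).
  apply: leq_trans leq_k; apply/subset_leq_card/subsetP => z /bigcupP[e ep ze].
  by have [y [c [_ Q]]] := pE _ _ ep ze; apply: pdom_Some Q.
have [f pf fp] := ext p pp ip lep.
exists (pair_of f) => [|x y c Q]; first exact: pair_of_coloring.
have [xy _] := mq _ _ _ Q; have [e E] := edge_exists xy.
have P := edge_precoloringE mq E Q; rewrite (pair_ofE _ E).
by have := fp e; rewrite inE P => /(_ isT)[].
Qed.

End ToPairs.

Section OfPairs.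
Variable t : nat.

(** [xchoose] orients each edge arbitrarily, which is harmless for a symmetric [g]. *)
Definition edge_coloring (g : G -> G -> 'I_t) : {ffun edge G -> 'I_t} :=
  [ffun e => let xy := xchoose (edge_ends e) in g xy.1 xy.2].

Lemma edge_coloringE g (e : edge G) x y :
  pair_coloring g -> val e = [set x; y] -> edge_coloring g e = g x y.
Proof.
case=> symg _ E; rewrite ffunE; have /andP[_ /eqP] := xchooseP (edge_ends e).
case: (xchoose _) => x' y' /=.
by rewrite E => /set2_eq[[-> ->]|[-> ->]].
Qed.

Lemma edge_coloring_proper g : pair_coloring g -> proper_coloring (edge_coloring g).
Proof.
move=> pg; apply/forallP => e1; apply/forallP => e2; apply/implyP.
case/andP=> ne12 /pred0Pn[x /= /andP[/edge_mem[y E1] /edge_mem[z E2]]].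
rewrite (edge_coloringE pg E1) (edge_coloringE pg E2).
apply: pg.2; [exact: edge_val2 E1 | exact: edge_val2 E2 |].
by apply: contraNneq ne12 => yz; apply/eqP/val_inj; rewrite E1 E2 yz.
Qed.

(** If the precolored edges are independent, at most one pair qualifies at [x], so [pick] makes no
    real choice. *)
Definition matching_of (p : {ffun edge G -> option 'I_t}) x : option (G * 'I_t) :=
  [pick yc | [exists e : edge G, (val e == [set x; yc.1]) && (p e == Some yc.2)]].

Lemma matching_ofP p x y c : matching_of p x = Some (y, c) ->
  exists2 e : edge G, val e = [set x; y] & p e = Some c.
Proof.
rewrite /matching_of; case: pickP => // yc /existsP[e /andP[/eqP E /eqP P]] [E'].
by exists e; move: E P; rewrite E'.
Qed.

Lemma matching_ofE p (e : edge G) x y c : independent (precolored p) ->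
  val e = [set x; y] -> p e = Some c -> matching_of p x = Some (y, c).
Proof.
move=> ip E P; case Q: (matching_of p x) => [[y' c']|]; last first.
  move: Q; rewrite /matching_of; case: pickP => // /(_ (y, c)) /existsP[].
  by exists e; rewrite E P /= !eqxx.
have [e' E' P'] := matching_ofP Q.
have ee' : e' = e.
  by apply: (independent_eq (x := x) ip); rewrite ?inE ?P ?P' ?E ?E' ?set21.
subst e'; move: P'; rewrite P => -[->].
by move: E'; rewrite E => /set2_eql ->.
Qed.

Lemma matching_of_cmatching p :
  independent (precolored p) -> cmatching (matching_of p).
Proof.
move=> ip x y c /matching_ofP[e E P]; split; first exact: edge_val2 E.
by apply: matching_ofE ip _ P; rewrite E setUC.
Qed.

Lemma card_matching_of p : #|pdom (matching_of p)| <= 2 * #|precolored p|.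
Proof.
apply: (@leq_trans #|\bigcup_(e in precolored p) val e|).
  apply/subset_leq_card/subsetP => x /pdomP[[y c] /matching_ofP[e E P]].
  by apply/bigcupP; exists e; rewrite ?inE ?P // E set21.
rewrite mulnC -sum_nat_const.
apply: (big_ind2 (fun (A : {set G}) n => #|A| <= n)) => [|A m B n lA lB|e _].
- by rewrite cards0.
- by apply: leq_trans (leq_card_setU A B) _; apply: leq_add.
- by rewrite card_edge.
Qed.

Lemma matching_of_extendable p g : independent (precolored p) ->
  pair_coloring g -> extends (matching_of p) g -> extendable p.
Proof.
move=> ip pg qg; exists (edge_coloring g); first exact: edge_coloring_proper.
move=> e; rewrite inE; case P: (p e) => [c|] // _.
have [[x y] /= /andP[_ /eqP E]] := edge_ends e.
by rewrite (edge_coloringE pg E) (qg _ _ _ (matching_ofE ip E P)).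
Qed.

End OfPairs.

End ColoredMatchings.

(** Deleting [c] by [unlift c] leaves [t] colors, for which the extension property is assumed;
    [lift c] renames them back and never takes the value [c]. *)
Lemma matching_extension_avoiding (G : sgraph) t k (c : 'I_t.+1) :
  (forall q : G -> option (G * 'I_t), cmatching q -> #|pdom q| <= k ->
    exists2 g, pair_coloring g & extends q g) ->
  forall q : G -> option (G * 'I_t.+1), cmatching q ->
  (forall x y, q x <> Some (y, c)) -> #|pdom q| <= k ->
  exists g, [/\ pair_coloring g, extends q g & forall x y, g x y != c].
Proof.
move=> ext q mq qc leqk.
pose q' x := if q x is Some (y, d) then omap (pair y) (unlift c d) else None.
have q'P x y d : q' x = Some (y, d) <-> q x = Some (y, lift c d).
  rewrite /q'; split=> [|->]; last by rewrite liftK.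
  case: (q x) => [[y' d']|] //.
  by case: unliftP => [d''|] //= -> [-> ->].
have [||g pg qg] := ext q'.
- by move=> x y d /q'P/mq[xy qy]; split=> //; apply/q'P.
- apply: leq_trans leqk; apply/subset_leq_card/subsetP => x.
  by case/pdomP=> -[y d] /q'P qx; apply: pdom_Some qx.
exists (fun x y => lift c (g x y)); split.
- split=> [x y|x y z xy xz yz]; first by rewrite pg.1.
  by rewrite (inj_eq lift_inj); apply: pg.2.
- move=> x y d qx; case: (unliftP c d) qx => [d' ->|->] qx; last by case: (qc x y).
  by congr lift; apply: qg; apply/q'P.
- by move=> x y; rewrite eq_sym neq_lift.
Qed.

(** * Private edges standing in for precolored vertical edges *)

Section Layers.
Variable G : sgraph.
Implicit Types x y z : G.

(** [F] is meant to be the set of vertices of [G] below all precolored edges. Each [x] in [pdom v]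
    receives its own neighbor outside [F]: as [x] lies in [F] and is not its own neighbor, at most
    [#|F| - 1] neighbors are forbidden, whence the [+ 1] in the hypothesis. *)
Lemma private_edges (C : Type) (v : G -> option C) (F : {set G}) :
  pdom v \subset F -> (forall x, #|pdom v| + #|F| <= degree x + 1) ->
  exists e : G -> option (G * C),
    [/\ cmatching e,
        forall x d, v x = Some d -> exists y, e x = Some (y, d),
        forall x y d, e x = Some (y, d) -> exists z, v z = Some d,
        [disjoint pdom e & F :\: pdom v] &
        #|pdom e| <= 2 * #|pdom v|].
Proof.
move=> vF deg; have [V0|/set0Pn[u0 _]] := eqVneq (pdom v) set0.
  exists (fun=> None); split=> //.
  - by move=> x d vx; have := pdom_Some vx; rewrite V0 inE.
  - by apply/pred0P => x; rewrite /= inE.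
  - by rewrite (_ : pdom _ = set0) ?cards0 //; apply/setP => x; rewrite !inE.
pose N x := [set y | adj x y] :\: F.
have [x xV|w winj wN] := distinct_representatives (N := N) (D := pdom v) u0.
  have := deg x; rewrite /N cardsD -/(degree x).
  have xF : x \in F by apply: (subsetP vF).
  have : #|[set y | adj x y] :&: F| <= #|F :\ x|.
    apply/subset_leq_card/subsetP => y; rewrite !inE => /andP[xy ->].
    by rewrite andbT; apply: contraTneq xy => ->; rewrite adj_irr.
  have := cardsD1 x F; rewrite xF; rewrite /degree; lia.
have wF x d : v x = Some d -> adj x (w x) /\ w x \notin F.
  by move=> vx; have := wN _ (pdom_Some vx); rewrite !inE => /andP[].
have vw x d : v x = Some d -> v (w x) = None.
  case/wF=> _ /negP wF'; apply: pdomN; apply/negP => /(subsetP vF); exact: wF'.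
(* [e] pairs each [x] in [pdom v] with [w x]. Both directions are well defined since [w] is
   injective on [pdom v] and takes it outside [F], hence outside [pdom v]. *)
pose e x := if v x is Some d then Some (w x, d) else
  if [pick z in pdom v | w z == x] is Some z then omap (pair z) (v z) else None.
have eP x y d : e x = Some (y, d) ->
    (v x = Some d /\ y = w x) \/ (v y = Some d /\ x = w y).
  rewrite /e; case vx: (v x) => [d'|]; first by case=> <- <-; left.
  case: pickP => // z /andP[_ /eqP <-]; case vz: (v z) => [d'|] //= [<- <-].
  by right.
have ev x d : v x = Some d -> e x = Some (w x, d) by rewrite /e => ->.
have ew x d : v x = Some d -> e (w x) = Some (x, d).
  move=> vx; rewrite /e (vw _ _ vx); case: pickP => [z /andP[zV /eqP wz]|].
    by rewrite (winj _ _ zV (pdom_Some vx) wz) vx.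
  by move=> /(_ x); rewrite (pdom_Some vx) eqxx.
exists e; split.
- move=> x y d /eP[[vx ->]|[vy ->]]; first by split; [case: (wF _ _ vx)|apply: ew].
  by split; [rewrite adj_sym; case: (wF _ _ vy)|apply: ev].
- by move=> x d vx; exists (w x); apply: ev.
- by move=> x y d /eP[[]|[]]; [exists x|exists y].
- rewrite disjoint_subset; apply/subsetP => x /pdomP[[y d] /eP[[vx _]|[vy ->]]].
    by rewrite !inE vx.
  by have [_] := wF _ _ vy; rewrite !inE negb_and => ->; rewrite orbT.
- rewrite mul2n -addnn; apply: (@leq_trans #|pdom v :|: w @: pdom v|).
    apply/subset_leq_card/subsetP => x /pdomP[[y d] /eP[[vx _]|[vy ->]]]; rewrite inE.
      by rewrite (pdom_Some vx).
    by rewrite imset_f ?orbT // (pdom_Some vy).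
  apply: leq_trans (leq_card_setU _ _) _.
  by rewrite leq_add2l leq_imset_card.
Qed.

(** * Swapping colors on the 4-cycles above a matching *)

Section Swap.
Variables (C : eqType) (c : C) (S : G -> option (G * C)).
Hypothesis mS : cmatching S.
Implicit Types g : G -> G -> C.

(* With vertical color [c], every edge [xy] of [S] lies in a 4-cycle of
   G x K_2 alternating between [c] and the color of [xy]; these cycles are
   disjoint and are all swapped. *)
Definition swap_layer g x y := if omap fst (S x) == Some y then c else g x y.
Definition swap_vertical g x := if S x is Some (y, _) then g x y else c.

Lemma swap_partner_sym x y :
  (omap fst (S x) == Some y) = (omap fst (S y) == Some x).
Proof.
wlog suff: x y / omap fst (S x) == Some y -> omap fst (S y) == Some x.
  by move=> sw; apply/idP/idP; apply: sw.
case Sx: (S x) => [[z d]|] //= /eqP[<-].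
by have [_ ->] := mS Sx.
Qed.

(** At most one edge at each vertex is recolored to [c], and [c] was absent before. *)
Lemma swap_layer_coloring g : pair_coloring g -> (forall x y, g x y != c) ->
  pair_coloring (swap_layer g).
Proof.
case=> symg pg gc; split=> [x y|x y z xy xz yz]; rewrite /swap_layer.
  by rewrite swap_partner_sym symg.
case: (_ =P Some y) => [->|_]; case: (_ =P Some z) => [|_].
- by case=> yz'; rewrite yz' eqxx in yz.
- by rewrite eq_sym.
- by [].
- exact: pg.
Qed.

(** The vertical edge above a matched [x] takes the old color of its matching edge, which no other
    layer edge at [x] has. Agreement on [S] allows the color to be read in [g1] while the layer is
    colored by [g2]. *)
Lemma swap_neq g1 g2 x y : pair_coloring g2 -> (forall x y, g2 x y != c) ->
  (forall x y d, S x = Some (y, d) -> g1 x y = g2 x y) ->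
  adj x y -> swap_layer g2 x y != swap_vertical g1 x.
Proof.
move=> pg g2c g12 xy; rewrite /swap_layer /swap_vertical.
case Sx: (S x) => [[z d]|] /=; last exact: g2c.
rewrite (g12 _ _ _ Sx); case: (_ =P Some y) => [_|zy]; first by rewrite eq_sym.
apply: pg.2 => //; first by case: (mS Sx).
by apply: contra_not_neq zy => ->.
Qed.

End Swap.

(** * Coloring both copies and the vertical edges *)

Section LayersColoring.
Variables (t k : nat).
Hypothesis deg : forall x, 2 * k < degree x.
Hypothesis ext : forall (c : 'I_t) (q : G -> option (G * 'I_t)), cmatching q ->
  (forall x y, q x <> Some (y, c)) -> #|pdom q| <= 2 * k ->
  exists g, [/\ pair_coloring g, extends q g & forall x y, g x y != c].

Definition layers_extendable (a b : G -> option (G * 'I_t)) (v : G -> option 'I_t) :=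
  exists ga gb h,
  [/\ pair_coloring ga /\ pair_coloring gb, extends a ga, extends b gb,
      forall x c, v x = Some c -> h x = c &
      forall x y, adj x y -> ga x y != h x /\ gb x y != h x].

Variables (a b : G -> option (G * 'I_t)) (v : G -> option 'I_t).
Hypotheses (ma : cmatching a) (mb : cmatching b).
Hypotheses (dav : [disjoint pdom a & pdom v]) (dbv : [disjoint pdom b & pdom v]).
Hypothesis size_abv : #|pdom a| + #|pdom b| + 2 * #|pdom v| <= 2 * k + 2.

(** Only precolored edges of color other than [c] are prescribed in the copies, a vertical one
    costing two vertices for its private edge. Edges of [a] colored [c] come from swapping, which
    needs equal colorings of both copies on them: either there are none, or [b] is empty and one
    coloring serves twice. *)
Lemma layers_extendable_with (c : 'I_t) :
  let vc x := if v x is Some d then if d != c then Some d else None else None in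
  #|pdom (pfilter a (predC1 c))| + 2 * #|pdom vc| <= 2 * k ->
  #|pdom (pfilter b (predC1 c))| + 2 * #|pdom vc| <= 2 * k ->
  (forall x y, b x <> Some (y, c)) ->
  (forall x y, a x <> Some (y, c)) \/ pdom b = set0 ->
  layers_extendable a b v.
Proof.
move=> vc lea leb bc abc.
have vcP x d : vc x = Some d <-> v x = Some d /\ d != c.
  rewrite /vc; case: (v x) => [d'|]; last by split=> [|[]].
  case: ifP => d'c; split=> [|[]] // [<-] //.
  by rewrite d'c.
have vcv : pdom vc \subset pdom v.
  by apply/subsetP => x /pdomP[d /vcP[vx _]]; apply: pdom_Some vx.
(* Since [size_abv] counts vertical edges twice, [#|pdom vc| + #|F|] is at most [2 * k + 2], hence
   at most [degree x + 1]. *)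
pose F := pdom a :|: pdom b :|: pdom v.
have [||e [me ev eC deF lee]] := @private_edges _ vc F.
- by apply: subset_trans vcv _; apply: subsetUr.
- move=> x; have := deg x; have := subset_leq_card vcv.
  have := (leq_card_setU (pdom a :|: pdom b) (pdom v)).1.
  have := (leq_card_setU (pdom a) (pdom b)).1; rewrite -/F; lia.
have ec x y : e x <> Some (y, c).
  by move/eC => [z /vcP[_]]; rewrite eqxx.
(* [e] meets [F] only inside [pdom v], where no layer edge is precolored. *)
have deq (q : G -> option (G * 'I_t)) P :
    pdom q \subset F -> [disjoint pdom q & pdom v] ->
    [disjoint pdom e & pdom (pfilter q P)].
  move=> qF qv; apply: disjointWr (pdom_filter q P) _.
  rewrite disjoint_sym; apply/pred0P => x; apply/negP => /= /andP[xq xe].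
  have := disjointFr deF xe; rewrite inE (subsetP qF) // andbT => /negbFE xv.
  by have := disjointFr qv xq; rewrite (subsetP vcv).
have aF : pdom a \subset F by rewrite /F -setUA subsetUl.
have bF : pdom b \subset F by rewrite /F setUAC subsetUr.
have coloring (q : G -> option (G * 'I_t)) : cmatching q -> pdom q \subset F ->
    [disjoint pdom q & pdom v] ->
    #|pdom (pfilter q (predC1 c))| + 2 * #|pdom vc| <= 2 * k ->
    exists g, [/\ pair_coloring g, forall x y, g x y != c, extends e g &
                  extends (pfilter q (predC1 c)) g].
  move=> mq qF qv leq.
  have dq := deq _ (predC1 c) qF qv.
  have [|x y||g [pg qg gc]] := @ext c (pjoin e (pfilter q (predC1 c))).
  - by apply: cmatching_join => //; apply: cmatching_filter.
  - rewrite /pjoin; case ex: (e x) => [z|]; first by rewrite -ex; apply: ec.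
    by case/pfilterP=> _ /=; rewrite eqxx.
  - rewrite pdom_join; apply: leq_trans (leq_card_setU _ _) _; lia.
  exists g; split=> // x y d qx; apply: qg; first exact: pjoinl.
  exact: pjoinr.
(* The edges to be swapped: private edges, and edges of [a] that must end up with color [c]. *)
pose S := pjoin e (pfilter a (pred1 c)).
have mS : cmatching S.
  apply: cmatching_join => //; first exact: cmatching_filter.
  exact: deq.
have [g1 [g2 [[pg1 g1c eg1 ag1] [pg2 g2c eg2 bg2] g12]]] : exists g1 g2,
    [/\ [/\ pair_coloring g1, forall x y, g1 x y != c, extends e g1 &
            extends (pfilter a (predC1 c)) g1],
        [/\ pair_coloring g2, forall x y, g2 x y != c, extends e g2 &
            extends (pfilter b (predC1 c)) g2] &
        forall x y d, S x = Some (y, d) -> g1 x y = g2 x y].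
  have [g1 [pg1 g1c eg1 ag1]] := coloring _ ma aF dav lea.
  case: abc => [ac|b0].
    have [g2 [pg2 g2c eg2 bg2]] := coloring _ mb bF dbv leb.
    exists g1, g2; split=> // x y d; rewrite /S /pjoin.
    case ex: (e x) => [[y' d']|]; first by case=> <- _; rewrite (eg1 _ _ _ ex) (eg2 _ _ _ ex).
    by case/pfilterP=> ax /eqP d_c; case: (ac x y); rewrite ax d_c.
  exists g1, g1; split=> //; split=> // x y d /pfilterP[bx _].
  by have := pdom_Some bx; rewrite b0 inE.
have Se x : e x = None -> S x = pfilter a (pred1 c) x by rewrite /S /pjoin => ->.
have eN (q : G -> option (G * 'I_t)) x y d : pdom q \subset F ->
    [disjoint pdom q & pdom v] -> q x = Some (y, d) -> e x = None.
  move=> qF qv qx; apply: pdomN; apply/negP => xe.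
  have := disjointFr (deq q predT qF qv) xe.
  by rewrite inE /pfilter qx.
exists (swap_layer c S g1), (swap_layer c S g2), (swap_vertical c S g1); split.
- by split; apply: swap_layer_coloring.
(* No private edge touches a precolored layer edge, so an edge of [a] is swapped exactly when its
   color is [c]. *)
- move=> x y d ax; rewrite /swap_layer (Se _ (eN _ _ _ _ aF dav ax)).
  rewrite /pfilter ax /=; case: (eqVneq d c) => [->|dc] /=; first by rewrite eqxx.
  by apply: ag1; apply/pfilterP.
- move=> x y d bx; rewrite /swap_layer (Se _ (eN _ _ _ _ bF dbv bx)).
  have dc : d != c by apply/eqP => dc; apply: (bc x y); rewrite bx dc.
  case ax: (pfilter _ _ _) => [[y' d']|] /=; last by apply: bg2; apply/pfilterP.
  case/pfilterP: ax => ax /eqP d'c; case: abc => [/(_ x y')|b0].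
    by rewrite ax d'c.
  by have := pdom_Some bx; rewrite b0 inE.
(* For [d != c] the swap brings up the color of the private edge; for [d = c] no edge of [S] meets
   [x], and the vertical edge keeps [c]. *)
- move=> x d vx; rewrite /swap_vertical; have [dc|dc] := eqVneq d c; last first.
    have [|y ex] := ev x d; first exact/vcP.
    by rewrite /S (pjoinl _ ex); apply: eg1 ex.
  have xv := pdom_Some vx.
  rewrite (_ : S x = None) // Se.
    apply: pdomN; apply: contraL xv => /(subsetP (pdom_filter _ _)) xa.
    by rewrite (disjointFr dav xa).
  apply: pdomN; apply/negP => xe.
  have := disjointFr deF xe; rewrite !inE vx orbT andbT /vc vx dc eqxx.
  by [].
- by move=> x y xy; split; apply: swap_neq.
Qed.

Hypothesis size_t : 2 * k + 1 < t.

(** Taking [c] from the precoloring saves the two units by which [size_abv] exceeds [2 * k]: the two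
    ends of an edge of [a], or one vertical edge, counted twice. *)
Lemma layers_extendable_single : pdom b = set0 -> layers_extendable a b v.
Proof.
move=> b0; have bN x yc : b x <> Some yc.
  by move=> bx; have := pdom_Some bx; rewrite b0 inE.
have sub0 P : #|pdom (pfilter b P)| = 0.
  by apply/eqP; rewrite cards_eq0 -subset0 -b0 pdom_filter.
suff [c lec] : exists c : 'I_t, #|pdom (pfilter a (predC1 c))| + 2 *
    #|pdom (fun x => if v x is Some d then if d != c then Some d else None else None)|
    <= 2 * k.
  apply: (@layers_extendable_with c) => //; last by right.
  by rewrite sub0; apply: leq_trans lec; apply: leq_addl.
have [a0|/set0Pn[x0 /pdomP[[y0 c] ax0]]] := eqVneq (pdom a) set0; last first.
  exists c; have [xy0 ay0] := ma ax0.
  have : #|pdom (pfilter a (predC1 c))| <= #|pdom a :\ x0 :\ y0|.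
    apply/subset_leq_card/subsetP => x /pdomP[[y d] /pfilterP[ax /= dc]].
    rewrite !in_setD1 (pdom_Some ax) andbT; apply/andP.
    by split; apply: contraNneq dc => xE; move: ax; rewrite xE ?ax0 ?ay0 => -[_ ->].
  have := cardsD1 x0 (pdom a); have := cardsD1 y0 (pdom a :\ x0).
  rewrite !in_setD1 (pdom_Some ax0) (pdom_Some ay0) andbT.
  have -> : y0 != x0 by apply: contraTneq xy0 => ->; rewrite adj_irr.
  set vc := fun x => _; have : #|pdom vc| <= #|pdom v|.
    apply/subset_leq_card/subsetP => x; rewrite !inE /vc.
    by case: (v x).
  move: size_abv; lia.
have a0' P : #|pdom (pfilter a P)| = 0.
  by apply/eqP; rewrite cards_eq0 -subset0 -a0 pdom_filter.
have [v0|/set0Pn[x0 /pdomP[c vx0]]] := eqVneq (pdom v) set0.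
  (* Nothing is precolored, so any color serves; this is color 0. *)
  exists (Ordinal (leq_trans (ltn0Sn _) size_t)); rewrite a0' (_ : pdom _ = set0) ?cards0 //.
  apply/setP => x; have : x \notin pdom v by rewrite v0 inE.
  by rewrite !inE; case: (v x).
exists c; rewrite a0'; set vc := fun x => _.
have : #|pdom vc| <= #|pdom v :\ x0|.
  apply/subset_leq_card/subsetP => x; rewrite !inE /vc.
  have [->|_] := eqVneq x x0; first by rewrite vx0 eqxx.
  by case: (v x).
have := cardsD1 x0 (pdom v); rewrite (pdom_Some vx0); move: size_abv; lia.
Qed.

Lemma layers_extendable_both :
  pdom a != set0 -> pdom b != set0 -> layers_extendable a b v.
Proof.
move=> a0 b0; have := card_pdom_gt0 ma a0; have := card_pdom_gt0 mb b0 => gtb gta.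
have [x0 x0a] := set0Pn _ a0.
(* The used colors. Dropping [x0] loses none, as its partner carries the same color, and brings the
   count down to [2 * k + 1], below [t]. *)
pose U := (omap snd \o a) @: (pdom a :\ x0) :|: (omap snd \o b) @: pdom b :|: v @: pdom v.
have /subsetPn[_ /imsetP[c _ ->]] : ~~ ([set Some c | c in 'I_t] \subset U).
  apply/negP => /subset_leq_card; apply/negP; rewrite -ltnNge.
  rewrite card_imset; last exact: Some_inj.
  rewrite card_ord; apply: leq_ltn_trans size_t.
  have := (leq_card_setU ((omap snd \o a) @: (pdom a :\ x0) :|:
                          (omap snd \o b) @: pdom b) (v @: pdom v)).1.
  have := (leq_card_setU ((omap snd \o a) @: (pdom a :\ x0))
                         ((omap snd \o b) @: pdom b)).1.
  have := leq_imset_card (omap snd \o a) (pdom a :\ x0).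
  have := leq_imset_card (omap snd \o b) (pdom b).
  have := leq_imset_card v (pdom v); rewrite -/U.
  have := cardsD1 x0 (pdom a); rewrite x0a; move: size_abv; lia.
rewrite !inE !negb_or => /andP[/andP[/imsetP aU /imsetP bU] /imsetP vU].
have ac' x y : x != x0 -> a x <> Some (y, c).
  move=> xx0 ax; case: aU; exists x; last by rewrite /= ax.
  by rewrite in_setD1 xx0 (pdom_Some ax).
have ac x y : a x <> Some (y, c).
  have [->|] := eqVneq x x0; last exact: ac'.
  move=> ax0; have [xy ay] := ma ax0; apply: (ac' y x0 _ ay).
  by apply: contraTneq xy => ->; rewrite adj_irr.
have bc x y : b x <> Some (y, c).
  by move=> bx; case: bU; exists x; [apply: pdom_Some bx|rewrite /= bx].
have lev : #|pdom (fun x => if v x is Some d then if d != c then Some d else None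
    else None)| <= #|pdom v|.
  by apply/subset_leq_card/subsetP => x; rewrite !inE; case: (v x).
have le_filter (q : G -> option (G * 'I_t)) : #|pdom q| + 2 * #|pdom v| <= 2 * k ->
    #|pdom (pfilter q (predC1 c))| + 2 * #|pdom (fun x => if v x is Some d then
      if d != c then Some d else None else None)| <= 2 * k.
  apply: leq_trans; apply: leq_add; last by rewrite leq_mul2l lev orbT.
  exact/subset_leq_card/pdom_filter.
apply: (@layers_extendable_with c) => //; last by left.
  by apply: le_filter; move: size_abv gtb; lia.
by apply: le_filter; move: size_abv gta; lia.
Qed.

End LayersColoring.

Lemma layers_extendable_sym t (a b : G -> option (G * 'I_t)) v :
  layers_extendable a b v -> layers_extendable b a v.
Proof.
case=> ga [gb [h [[pa pb] ea eb ev hN]]]; exists gb, ga, h; split=> // x y xy.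
by have [] := hN x y xy.
Qed.

Lemma layers_extendableP t k (a b : G -> option (G * 'I_t)) v :
  (forall x, 2 * k < degree x) ->
  (forall (c : 'I_t) (q : G -> option (G * 'I_t)), cmatching q ->
    (forall x y, q x <> Some (y, c)) -> #|pdom q| <= 2 * k ->
    exists g, [/\ pair_coloring g, extends q g & forall x y, g x y != c]) ->
  2 * k + 1 < t ->
  cmatching a -> cmatching b ->
  [disjoint pdom a & pdom v] -> [disjoint pdom b & pdom v] ->
  #|pdom a| + #|pdom b| + 2 * #|pdom v| <= 2 * k + 2 ->
  layers_extendable a b v.
Proof.
move=> deg ext size_t ma mb av bv size_abv.
have [b0|b0] := eqVneq (pdom b) set0; first exact: layers_extendable_single.
have [a0|a0] := eqVneq (pdom a) set0; last exact: layers_extendable_both.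
apply/layers_extendable_sym; apply: layers_extendable_single => //.
by rewrite [#|_| + #|_|]addnC.
Qed.
End Layers.

(** * Splitting a matching of the product and gluing colorings *)

Section ProductK2.
Variables (G : sgraph) (t : nat).
Let K := G □ 'K_2.
Implicit Types (x y : G) (i j : 'I_2).

Definition layer (q : K -> option (K * 'I_t)) i x : option (G * 'I_t) :=
  if q (x, i) is Some ((y, _), c) then if y != x then Some (y, c) else None
  else None.

(** Reading the copy [ord0] suffices, since a vertical edge has an end in each copy. *)
Definition vertical (q : K -> option (K * 'I_t)) x : option 'I_t :=
  if q (x, ord0) is Some ((y, _), c) then if y == x then Some c else None
  else None.

Lemma ord2P i : i = ord0 \/ i = ord_max.
Proof. by case: i => [[|[|//]] ilt]; [left|right]; apply: val_inj. Qed.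

Variable q : K -> option (K * 'I_t).
Hypothesis mq : cmatching q.

Lemma layerP i x y c : layer q i x = Some (y, c) <-> x != y /\ q (x, i) = Some ((y, i), c).
Proof.
rewrite /layer; case qx: (q (x, i)) => [[[y' j] d]|]; last by split=> [|[]].
have [] := mq qx; rewrite /adj /= /cart_adj /= => xy _.
have [yx|yx] := eqVneq y' x; rewrite /=; split=> //.
- by case=> xy' [yE _ _]; rewrite -yE yx eqxx in xy'.
- move: xy; rewrite eq_sym (negPf yx) /= => /andP[_ /eqP ij] [<- <-].
  by rewrite eq_sym yx ij.
- by case=> _ [-> _ ->].
Qed.

Lemma verticalP x c : vertical q x = Some c <-> q (x, ord0) = Some ((x, ord_max), c).
Proof.
rewrite /vertical; case qx: (q (x, ord0)) => [[[y' j] d]|]; last by [].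
have [] := mq qx; rewrite /adj /= /cart_adj /= => xy _.
have [yx|yx] := eqVneq y' x; rewrite /=; split=> //.
- case=> <-; move: xy; rewrite yx adj_irr eqxx /= orbF.
  by case: (ord2P j) => ->.
- by case=> _ _ ->.
- by case=> yE; rewrite yE eqxx in yx.
Qed.

Lemma verticalP' x i j c : q (x, i) = Some ((x, j), c) -> vertical q x = Some c.
Proof.
move=> qx; have [] := mq qx; rewrite /adj /= /cart_adj /= adj_irr eqxx orbF /=.
move=> ij qx'; apply/verticalP.
by move: ij qx qx'; case: (ord2P i) => ->; case: (ord2P j) => ->.
Qed.

Lemma layer_cmatching i : cmatching (layer q i).
Proof.
move=> x y c /layerP[xy qx]; have [] := mq qx; rewrite /adj /= /cart_adj /=.
rewrite (negPf xy) eqxx andbT /= => axy qy; split=> //.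
by apply/layerP; rewrite eq_sym.
Qed.

Lemma vertical_dom i x c :
  vertical q x = Some c -> exists j, q (x, i) = Some ((x, j), c).
Proof.
move/verticalP=> qx; have [_ qx'] := mq qx.
by case: (ord2P i) => ->; [exists ord_max|exists ord0].
Qed.

Lemma layer_vertical_disjoint i : [disjoint pdom (layer q i) & pdom (vertical q)].
Proof.
apply/pred0P => x; apply/negP => /= /andP[/pdomP[[y c] /layerP[xy qx]] /pdomP[d]].
move/(vertical_dom i) => [j]; rewrite qx => -[yx].
by rewrite yx eqxx in xy.
Qed.

(** A vertical edge covers one vertex in each copy, hence the factor 2; within a copy its end is
    distinct from those of layer edges. *)
Lemma card_layers :
  #|pdom (layer q ord0)| + #|pdom (layer q ord_max)| + 2 * #|pdom (vertical q)|
  <= #|pdom q|.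
Proof.
pose D i := [set (x, i) | x in pdom (layer q i) :|: pdom (vertical q)].
have cardD i : #|D i| = #|pdom (layer q i)| + #|pdom (vertical q)|.
  rewrite card_imset; last by move=> x y [].
  by apply/eqP; rewrite (leq_card_setU _ _).2 layer_vertical_disjoint.
have subD i : D i \subset pdom q.
  apply/subsetP => _ /imsetP[x + ->]; rewrite inE => /orP[]/pdomP.
    by case=> -[y c] /layerP[_ qx]; apply: pdom_Some qx.
  by case=> c /(vertical_dom i)[j qx]; apply: pdom_Some qx.
have dis : [disjoint D ord0 & D ord_max].
  by apply/pred0P => u; apply/negP => /= /andP[/imsetP[x _ ->] /imsetP[y _ []]].
apply: (@leq_trans #|D ord0 :|: D ord_max|).
  rewrite (eqP (etrans (leq_card_setU _ _).2 dis)) !cardD; lia.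
by apply: subset_leq_card; rewrite subUset !subD.
Qed.

Lemma layers_extends :
  layers_extendable (layer q ord0) (layer q ord_max) (vertical q) ->
  exists2 g, pair_coloring g & extends q g.
Proof.
case=> ga [gb [h [[pa pb] ea eb ev hN]]].
pose gl i := if i == ord0 then ga else gb.
have pl i : pair_coloring (gl i) by rewrite /gl; case: ifP.
have hl i x y : adj x y -> gl i x y != h x.
  by move/hN => []; rewrite /gl; case: ifP.
have el i : extends (layer q i) (gl i) by case: (ord2P i) => ->.
(* The [maxn] only serves to make [g] symmetric on non-edges. *)
pose g (u w : K) : 'I_t :=
  if u.1 == w.1 then h u.1 else gl (inord (maxn u.2 w.2)) u.1 w.1.
have gE x i y : x != y -> g (x, i) (y, i) = gl i x y.
  by move=> /negPf xy; rewrite /g /= xy maxnn inord_val.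
have gv x i j : g (x, i) (x, j) = h x by rewrite /g /= eqxx.
have adjE x i y j : @adj K (x, i) (y, j) -> (x = y /\ i != j) \/ [/\ adj x y, x != y & i = j].
  rewrite /adj /= /cart_adj /=; case/orP=> /andP[]; first by move=> /eqP; left.
  move=> xy /eqP; right; split=> //.
  by apply: contraTneq xy => ->; rewrite adj_irr.
exists g.
  split=> [[x i] [y j]|[x i] [y j] [z l]].
    by rewrite /g /= eq_sym maxnC; case: eqP => [->|_] //; apply: (pl _).1.
  (* Each of the two edges is vertical or in a layer. Two vertical edges at one vertex coincide, as
     [K_2] has only two vertices. *)
  move=> /adjE[[<- ij]|[xy nxy <-]] /adjE[[<- il]|[xz nxz <-]] neq.
  - case/eqP: neq; congr pair.
    by move: ij il; case: (ord2P i) => ->; case: (ord2P j) => ->; case: (ord2P l) => ->.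
  - by rewrite gv gE // eq_sym; apply: hl.
  - by rewrite gv gE //; apply: hl.
  - rewrite !gE //; apply: (pl i).2 => //.
    by apply: contraNneq neq => ->.
move=> [x i] [y j] c qx; have [/adjE[[xy _]|[_ xy ij]] _] := mq qx.
  by move: qx; rewrite -xy gv => /verticalP' /ev.
by subst j; rewrite gE //; apply: el; apply/layerP.
Qed.

End ProductK2.

(** * Degree bound and conclusion *)

Lemma degree_le_colors (G : sgraph) t (g : G -> G -> 'I_t) (x : G) :
  pair_coloring g -> degree x <= t.
Proof.
case=> _ pg; rewrite -[leqRHS]card_ord /degree -(@card_in_imset _ _ (g x)).
  exact: max_card.
move=> y z; rewrite !inE => xy xz gyz; apply/eqP; apply: contraT => yz.
by have := pg _ _ _ xy xz yz; rewrite gyz eqxx.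
Qed.

Theorem theorem3p2 (G : sgraph) (k : nat) :
  regular G ->
  2 * k < max_degree G ->
  (forall p : {ffun edge G -> option 'I_(chromatic_index G)},
     proper_precoloring p ->
     independent (precolored p) ->
     #|precolored p| <= k ->
     extendable p) ->
  forall p : {ffun edge (G □ 'K_2) -> option 'I_(chromatic_index G + 1)},
    proper_precoloring p ->
    independent (precolored p) ->
    #|precolored p| <= k + 1 ->
    extendable p.
Proof.
case=> d regG ltk ext; rewrite addn1 => p _ ip lep.
have deg (x : G) : 2 * k < degree x.
  apply: leq_trans ltk _; apply/bigmax_leqP => y _.
  by rewrite !regG.
have [x0 _|G0] := pickP (fun _ : G => true); last first.
  by move: ltk; rewrite /max_degree big_pred0 // ltn0.
(* An actual edge is needed to provide the junk color of [pair_of]. *)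
have [y0 xy0] : exists y0, adj x0 y0.
  have : 0 < degree x0 by apply: leq_ltn_trans (deg x0).
  by case/card_gt0P => y; rewrite inE; exists y.
have [e0 _] := edge_exists xy0.
have ext' := matching_extension e0 ext.
(* Extending the empty matching yields a proper coloring with [chromatic_index G] colors, which
   bounds the degree and gives enough colors for [size_t]. *)
have [||g pg _] := ext' (fun=> None).
- by move=> x y c.
- by rewrite (_ : pdom _ = set0) ?cards0 //; apply/setP => x; rewrite !inE.
have size_t : 2 * k + 1 < (chromatic_index G).+1.
  by rewrite addn1 ltnS; apply: leq_trans (deg x0) (degree_le_colors _ pg).
have mq := matching_of_cmatching ip.
have [|gK pgK eK] := layers_extends mq; last exact: matching_of_extendable pgK eK.
apply: (layers_extendableP deg _ size_t).
- by move=> c q mq' qc leq; apply: matching_extension_avoiding ext' _ mq' qc leq.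
- exact: layer_cmatching.
- exact: layer_cmatching.
- exact: layer_vertical_disjoint.
- exact: layer_vertical_disjoint.
- apply: leq_trans (card_layers mq) _; apply: leq_trans (card_matching_of p) _.
  by rewrite -[X in _ <= _ + X](muln1 2) -mulnDr leq_pmul2l.
Qed.
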